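(* Let $\psi_{\mathsf{true}}(\mathsf{AxFTCpm}^{\mathsf{cl}})$ be the set of first-order formulae over $\Sigma^d_{md,\bot}$ obtained by applying the translation $\psi_{\mathsf{true}}$ to each of the universally closed axioms of partial meadows listed in the context, and let $P$ be the set of the following (universally quantified) properties: $0\neq\bot$; $1\neq\bot$; $-\bot=\bot$; $x+\bot=\bot+x=\bot$; $x\cdot\bot=\bot\cdot x=\bot$; $\frac x\bot=\frac\bot x=\bot$; $\frac x0=\bot$; $-x=\bot\to x=\bot$; $x+y=\bot\to(x=\bot\vee y=\bot)$; $x\cdot y=\bot\to(x=\bot\vee y=\bot)$. Then: (a) $P\cup\psi_{\mathsf{true}}(\mathsf{AxFTCpm}^{\mathsf{cl}})\vdash\mathsf{AxFTCcm}$, i.e. every axiom of $\mathsf{AxFTCcm}$ (listed in the context) is derivable in classical first-order logic from $P\cup\psi_{\mathsf{true}}(\mathsf{AxFTCpm}^{\mathsf{cl}})$; and (b) $P\cup\psi_{\mathsf{true}}(\mathsf{AxFTCpm}^{\mathsf{cl}})$ axiomatises common meadows: its models are exactly the common meadows.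
   Context: Signature. $\Sigma^d_{md,\bot}$ has one sort, constants $0,1,\bot$, and total functions $+,\cdot$ (binary), $-$ (unary) and division $\frac xy$ (binary). Common meadow. A common meadow is an enlargement $F_\bot$ of a field $F$ obtained by adding to the domain a new absorptive element $\bot$ (so $-\bot=\bot$, and $+$, $\cdot$ give $\bot$ when an argument is $\bot$), named by the constant $\bot$, and adding a division function that is the usual one for elements of $F$ with non-zero denominator and is made total by $\frac x0=\frac x\bot=\frac\bot x=\bot$. Axioms $\mathsf{AxFTCpm}^{\mathsf{cl}}$. These are formulae of a sequential logic whose atoms are $t=_{\mathsf p}r$ ($t,r$ terms without $\bot$), with connectives $\neg,\vee_\ell$, universal quantifier $\forall_{\mathsf p}$, and abbreviations $\phi\wedge_\ell\psi:=\neg(\neg\phi\vee_\ell\neg\psi)$, $\phi\to_\ell\psi:=\neg\phi\vee_\ell\psi$, $t\neq_{\mathsf p}r:=\neg(t=_{\mathsf p}r)$. The axioms are the closures, by quantifiers $\forall_{\mathsf p}$ over all occurring variables, of: $(x+y)+z=_{\mathsf p}x+(y+z)$; $x+0=_{\mathsf p}x$; $x+(-x)=_{\mathsf p}0$; $x\cdot(y\cdot z)=_{\mathsf p}(x\cdot y)\cdot z$; $x\cdot y=_{\mathsf p}y\cdot x$; $1\cdot x=_{\mathsf p}x$; $x\cdot(y+z)=_{\mathsf p}(x\cdot y)+(x\cdot z)$; $y\neq_{\mathsf p}0\to_\ell\frac xy=_{\mathsf p}x\cdot\frac1y$; $x\neq_{\mathsf p}0\to_\ell\frac xx=_{\mathsf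 p}1$; $0\neq_{\mathsf p}1$; $(x\neq_{\mathsf p}0\wedge_\ell y\neq_{\mathsf p}0)\to_\ell x\cdot y\neq_{\mathsf p}0$. Translation. $\psi_{\mathsf{true}},\psi_{\mathsf{false}}$ map such formulae to classical first-order formulae over $\Sigma^d_{md,\bot}$ (only the clauses needed for the axioms above are listed): - $\psi_{\mathsf{true}}(t=_{\mathsf p}r)\equiv t\neq\bot\wedge r\neq\bot\wedge t=r$; - $\psi_{\mathsf{false}}(t=_{\mathsf p}r)\equiv t=\bot\vee r=\bot\vee t\neq r$; - $\psi_{\mathsf{true}}(\neg\phi)\equiv\psi_{\mathsf{false}}(\phi)$; $\psi_{\mathsf{false}}(\neg\phi)\equiv\psi_{\mathsf{true}}(\phi)$; - $\psi_{\mathsf{true}}(\phi_1\vee_\ell\phi_2)\equiv\psi_{\mathsf{true}}(\phi_1)\vee(\psi_{\mathsf{false}}(\phi_1)\wedge\psi_{\mathsf{true}}(\phi_2))$; - $\psi_{\mathsf{false}}(\phi_1\vee_\ell\phi_2)\equiv\psi_{\mathsf{false}}(\phi_1)\wedge\psi_{\mathsf{false}}(\phi_2)$; - $\psi_{\mathsf{true}}(\forall_{\mathsf p}x.\phi)\equiv\forall x.(x\neq\bot\to\psi_{\mathsf{true}}(\phi))$. Axioms $\mathsf{AxFTCcm}$ (universally quantified equations over $\Sigma^d_{md,\bot}$): $(x+y)+z=x+(y+z)$; $x+y=y+x$; $x+0=x$; $x+(-x)=0\cdot x$; $(x\cdot y)\cdot z=x\cdot(y\cdot z)$; $x\cdot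 y=y\cdot x$; $1\cdot x=x$; $x\cdot(y+z)=(x\cdot y)+(x\cdot z)$; $-(-x)=x$; $x+\bot=\bot$; $\frac xy=x\cdot\frac1y$; $\frac xx=1+\frac0x$; $\frac1{x\cdot y}=\frac1x\cdot\frac1y$; $\frac1{1+(0\cdot x)}=1+(0\cdot x)$; $\bot=\frac10$. *)

(* Defs.v *)
(* MathComp is used for fields; everything else is plain inductive types. *)
From Stdlib Require Import List.
From mathcomp Require Import all_boot all_algebra.

Set Implicit Arguments.
Unset Strict Implicit.
Unset Printing Implicit Defensive.

Import GRing.Theory.

(* ---- Classical first-order logic over the signature of common meadows ---- *)

(* Variables are de Bruijn indices: [Var 0] is bound by the innermost
   quantifier. *)
Inductive term : Type :=
| Var of nat
| Zero
| One
| Bot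
| Add of term & term
| Mul of term & term
| Opp of term
| Div of term & term.

Inductive form : Type :=
| Eq of term & term
| Fal
| And of form & form
| Or of form & form
| Imp of form & form
| All of form
| Ex of form.

Definition Neg (p : form) : form := Imp p Fal.
Definition Neq (s t : term) : form := Neg (Eq s t).

Declare Scope cm_term_scope.
Delimit Scope cm_term_scope with cmt.
Bind Scope cm_term_scope with term.
Notation "0" := Zero : cm_term_scope.
Notation "1" := One : cm_term_scope.
Notation "s + t" := (Add s t) : cm_term_scope.
Notation "s * t" := (Mul s t) : cm_term_scope.
Notation "- t" := (Opp t) : cm_term_scope.
Notation "s / t" := (Div s t) : cm_term_scope.

Declare Scope fol_scope.
Delimit Scope fol_scope with fol.
Bind Scope fol_scope with form.
Notation "s == t" := (Eq s%cmt t%cmt) : fol_scope.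
Notation "s != t" := (Neq s%cmt t%cmt) : fol_scope.
Notation "~ p" := (Neg p) : fol_scope.
Notation "p /\ q" := (And p q) : fol_scope.
Notation "p \/ q" := (Or p q) : fol_scope.
Notation "p -> q" := (Imp p q) : fol_scope.

Definition all_n (n : nat) (p : form) : form := iter n All p.

Fixpoint tsubst (sigma : nat -> term) (t : term) : term :=
  match t with
  | Var n => sigma n
  | Zero => Zero
  | One => One
  | Bot => Bot
  | Add s t => Add (tsubst sigma s) (tsubst sigma t)
  | Mul s t => Mul (tsubst sigma s) (tsubst sigma t)
  | Opp t => Opp (tsubst sigma t)
  | Div s t => Div (tsubst sigma s) (tsubst sigma t)
  end.

Definition shift (n : nat) : term := Var n.+1.

Definition scons {T : Type} (a : T) (sigma : nat -> T) (n : nat) : T :=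
  if n is m.+1 then sigma m else a.

Definition up (sigma : nat -> term) : nat -> term :=
  scons (Var 0) (fun n => tsubst shift (sigma n)).

Fixpoint fsubst (sigma : nat -> term) (p : form) : form :=
  match p with
  | Eq s t => Eq (tsubst sigma s) (tsubst sigma t)
  | Fal => Fal
  | And p q => And (fsubst sigma p) (fsubst sigma q)
  | Or p q => Or (fsubst sigma p) (fsubst sigma q)
  | Imp p q => Imp (fsubst sigma p) (fsubst sigma q)
  | All p => All (fsubst (up sigma) p)
  | Ex p => Ex (fsubst (up sigma) p)
  end.

Definition lift (p : form) : form := fsubst shift p.

(* [inst t p] substitutes [t] for the outermost free index of [p], undoing one
   binder. *)
Definition inst (t : term) (p : form) : form := fsubst (scons t Var) p.

(* Natural deduction for classical first-order logic with equality. Ex falso is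
   the instance of [RAA] with a vacuous discharge. *)
Inductive derives : list form -> form -> Prop :=
| Hyp G p : In p G -> derives G p
| ImpI G p q : derives (p :: G) q -> derives G (Imp p q)
| ImpE G p q : derives G (Imp p q) -> derives G p -> derives G q
| AndI G p q : derives G p -> derives G q -> derives G (And p q)
| AndE1 G p q : derives G (And p q) -> derives G p
| AndE2 G p q : derives G (And p q) -> derives G q
| OrI1 G p q : derives G p -> derives G (Or p q)
| OrI2 G p q : derives G q -> derives G (Or p q)
| OrE G p q r :
    derives G (Or p q) -> derives (p :: G) r -> derives (q :: G) r ->
    derives G r
| RAA G p : derives (Neg p :: G) Fal -> derives G p
| AllI G p : derives (List.map lift G) p -> derives G (All p)
| AllE G p t : derives G (All p) -> derives G (inst t p)
| ExI G p t : derives G (inst t p) -> derives G (Ex p)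
| ExE G p q :
    derives G (Ex p) -> derives (p :: List.map lift G) (lift q) -> derives G q
| EqRefl G t : derives G (Eq t t)
| EqSubst G p s t : derives G (Eq s t) -> derives G (inst s p) ->
    derives G (inst t p).

(* ---- Structures, satisfaction, models ---- *)

Record structure : Type := Structure {
  carrier :> Type;
  zero_ : carrier;
  one_ : carrier;
  bot_ : carrier;
  add_ : carrier -> carrier -> carrier;
  mul_ : carrier -> carrier -> carrier;
  opp_ : carrier -> carrier;
  div_ : carrier -> carrier -> carrier
}.

Fixpoint eval (A : structure) (rho : nat -> A) (t : term) : A :=
  match t with
  | Var n => rho n
  | Zero => zero_ A
  | One => one_ A
  | Bot => bot_ A
  | Add s t => add_ (eval rho s) (eval rho t)
  | Mul s t => mul_ (eval rho s) (eval rho t)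
  | Opp t => opp_ (eval rho t)
  | Div s t => div_ (eval rho s) (eval rho t)
  end.

Fixpoint sat (A : structure) (rho : nat -> A) (p : form) : Prop :=
  match p with
  | Eq s t => eval rho s = eval rho t
  | Fal => False
  | And p q => sat rho p /\ sat rho q
  | Or p q => sat rho p \/ sat rho q
  | Imp p q => sat rho p -> sat rho q
  | All p => forall a : A, sat (scons a rho) p
  | Ex p => exists a : A, sat (scons a rho) p
  end.

Definition is_model (A : structure) (T : list form) : Prop :=
  forall p : form, In p T -> forall rho : nat -> A, sat rho p.

(* ---- Common meadows ---- *)

Section Enlargement.
Variable F : fieldType.
Local Open Scope ring_scope.

Definition bot_add (x y : option F) : option F :=
  match x, y with Some a, Some b => Some (a + b) | _, _ => None end.

Definition bot_mul (x y : option F) : option F :=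
  match x, y with Some a, Some b => Some (a * b) | _, _ => None end.

Definition bot_opp (x : option F) : option F :=
  match x with Some a => Some (- a) | None => None end.

Definition bot_div (x y : option F) : option F :=
  match x, y with
  | Some a, Some b => if b == 0 then None else Some (a / b)
  | _, _ => None
  end.

(* The new absorptive element is [None]. *)
Definition enlargement : structure :=
  Structure (Some 0) (Some 1) None bot_add bot_mul bot_opp bot_div.

End Enlargement.

Definition isomorphism (A B : structure) (h : A -> B) : Prop :=
  bijective h /\
  h (zero_ A) = zero_ B /\
  h (one_ A) = one_ B /\
  h (bot_ A) = bot_ B /\
  (forall x y, h (add_ x y) = add_ (h x) (h y)) /\
  (forall x y, h (mul_ x y) = mul_ (h x) (h y)) /\
  (forall x, h (opp_ x) = opp_ (h x)) /\
  (forall x y, h (div_ x y) = div_ (h x) (h y)).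

(* The identity of the element adjoined to the field is immaterial, so the
   class of common meadows is closed under isomorphism. *)
Definition common_meadow (A : structure) : Prop :=
  exists (F : fieldType) (h : enlargement F -> A), isomorphism h.

(* ---- The sequential logic of partial meadows ---- *)

Inductive pterm : Type :=
| PVar of nat
| PZero
| POne
| PAdd of pterm & pterm
| PMul of pterm & pterm
| POpp of pterm
| PDiv of pterm & pterm.

Inductive pform : Type :=
| PEq of pterm & pterm
| PNeg of pform
| POr of pform & pform
| PAll of pform.

Definition PAnd (p q : pform) : pform := PNeg (POr (PNeg p) (PNeg q)).
Definition PImp (p q : pform) : pform := POr (PNeg p) q.
Definition PNeq (s t : pterm) : pform := PNeg (PEq s t).

Declare Scope pterm_scope.
Delimit Scope pterm_scope with pterm.
Bind Scope pterm_scope with pterm.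
Notation "0" := PZero : pterm_scope.
Notation "1" := POne : pterm_scope.
Notation "s + t" := (PAdd s t) : pterm_scope.
Notation "s * t" := (PMul s t) : pterm_scope.
Notation "- t" := (POpp t) : pterm_scope.
Notation "s / t" := (PDiv s t) : pterm_scope.

Declare Scope seq_logic_scope.
Delimit Scope seq_logic_scope with sql.
Bind Scope seq_logic_scope with pform.
Notation "s == t" := (PEq s%pterm t%pterm) : seq_logic_scope.
Notation "s != t" := (PNeq s%pterm t%pterm) : seq_logic_scope.
Notation "p /\ q" := (PAnd p q) : seq_logic_scope.
Notation "p -> q" := (PImp p q) : seq_logic_scope.

Definition pall_n (n : nat) (p : pform) : pform := iter n PAll p.

Section PartialMeadowAxioms.
Local Open Scope seq_logic_scope.
Local Notation x := (PVar 0).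
Local Notation y := (PVar 1).
Local Notation z := (PVar 2).

Definition AxFTCpm_cl : list pform :=
  [:: pall_n 3 ((x + y) + z == x + (y + z));
      pall_n 1 (x + 0 == x);
      pall_n 1 (x + (- x) == 0);
      pall_n 3 (x * (y * z) == (x * y) * z);
      pall_n 2 (x * y == y * x);
      pall_n 1 (1 * x == x);
      pall_n 3 (x * (y + z) == (x * y) + (x * z));
      pall_n 2 (y != 0 -> x / y == x * (1 / y));
      pall_n 1 (x != 0 -> x / x == 1);
      0 != 1;
      pall_n 2 ((x != 0 /\ y != 0) -> x * y != 0)].
End PartialMeadowAxioms.

(* ---- The translation to classical first-order logic ---- *)

Fixpoint embed (t : pterm) : term :=
  match t with
  | PVar n => Var n
  | PZero => Zero
  | POne => One
  | PAdd s t => Add (embed s) (embed t)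
  | PMul s t => Mul (embed s) (embed t)
  | POpp t => Opp (embed t)
  | PDiv s t => Div (embed s) (embed t)
  end.

(* The clause of [psi_false] for [PAll] is dual to that of [psi_true]. It is
   never used for a prenex universal formula, hence for no axiom above. *)
Fixpoint psi_true (p : pform) : form :=
  match p with
  | PEq t r =>
      embed t != Bot /\ (embed r != Bot /\ embed t == embed r)
  | PNeg p => psi_false p
  | POr p q => psi_true p \/ (psi_false p /\ psi_true q)
  | PAll p => All (Var 0 != Bot -> psi_true p)
  end%fol
with psi_false (p : pform) : form :=
  match p with
  | PEq t r =>
      embed t == Bot \/ (embed r == Bot \/ embed t != embed r)
  | PNeg p => psi_true p
  | POr p q => psi_false p /\ psi_false q
  | PAll p => Ex (Var 0 != Bot /\ psi_false p)
  end%fol.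

Section CommonMeadowAxioms.
Local Open Scope fol_scope.
Local Notation x := (Var 0).
Local Notation y := (Var 1).
Local Notation z := (Var 2).

Definition P_axioms : list form :=
  [:: 0 != Bot;
      1 != Bot;
      - Bot == Bot;
      all_n 1 (x + Bot == Bot);
      all_n 1 (Bot + x == Bot);
      all_n 1 (x * Bot == Bot);
      all_n 1 (Bot * x == Bot);
      all_n 1 (x / Bot == Bot);
      all_n 1 (Bot / x == Bot);
      all_n 1 (x / 0 == Bot);
      all_n 1 (- x == Bot -> x == Bot);
      all_n 2 (x + y == Bot -> (x == Bot \/ y == Bot));
      all_n 2 (x * y == Bot -> (x == Bot \/ y == Bot))].

Definition AxFTCcm : list form :=
  [:: all_n 3 ((x + y) + z == x + (y + z));
      all_n 2 (x + y == y + x);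
      all_n 1 (x + 0 == x);
      all_n 1 (x + (- x) == 0 * x);
      all_n 3 ((x * y) * z == x * (y * z));
      all_n 2 (x * y == y * x);
      all_n 1 (1 * x == x);
      all_n 3 (x * (y + z) == (x * y) + (x * z));
      all_n 1 (- (- x) == x);
      all_n 1 (x + Bot == Bot);
      all_n 2 (x / y == x * (1 / y));
      all_n 1 (x / x == 1 + 0 / x);
      all_n 2 (1 / (x * y) == (1 / x) * (1 / y));
      all_n 1 (1 / (1 + (0 * x)) == 1 + (0 * x));
      Bot == 1 / 0].
End CommonMeadowAxioms.

(* Main.v *)
(* Defined elements satisfy the ring axioms except for commutativity of
   addition; the latter follows by expanding (1 + 1)(x + y) in two ways and
   cancelling.  (a) The relation "Gamma proves s = t" is a congruence on terms,
   for which equational reasoning is available once the terms involved are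
   provably different from bot.  Classical case distinctions on t = bot and
   t = 0 inside the calculus reduce every axiom of common meadows to such
   reasoning, the degenerate cases being absorbed by P.  (b) The elements of a
   model other than bot form a field.  Conversely the enlargement of a field
   satisfies the axioms, and satisfaction is invariant under isomorphism. *)
From HB Require Import structures.
From Stdlib Require Import List Setoid Morphisms.
From mathcomp Require Import all_boot all_algebra.
From mathcomp Require Import boolp.
Require Import Defs.

Set Implicit Arguments.
Unset Strict Implicit.
Unset Printing Implicit Defensive.

Import GRing.Theory.

(** * Substitution *)

Lemma tsubst_ext sigma tau t : sigma =1 tau -> tsubst sigma t = tsubst tau t.
Proof. by move=> e; elim: t => //= [s -> t ->|s -> t ->|t ->|s -> t ->]. Qed.

Lemma tsubst_comp sigma tau t :
  tsubst sigma (tsubst tau t) = tsubst (fun n => tsubst sigma (tau n)) t.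
Proof. by elim: t => //= [s -> t ->|s -> t ->|t ->|s -> t ->]. Qed.

Lemma tsubst_id t : tsubst Var t = t.
Proof. by elim: t => //= [s -> t ->|s -> t ->|t ->|s -> t ->]. Qed.

Lemma tsubst_scons_shift a sigma t :
  tsubst (scons a sigma) (tsubst shift t) = tsubst sigma t.
Proof. by rewrite tsubst_comp; apply: tsubst_ext. Qed.

Lemma up_ext sigma tau : sigma =1 tau -> up sigma =1 up tau.
Proof. by move=> e [|n] //=; rewrite e. Qed.

Lemma fsubst_ext sigma tau p : sigma =1 tau -> fsubst sigma p = fsubst tau p.
Proof.
elim: p sigma tau => //= [s t|p IHp q IHq|p IHp q IHq|p IHp q IHq|p IH|p IH]
  sigma tau e; rewrite ?(tsubst_ext _ e) //.
- by rewrite (IHp _ _ e) (IHq _ _ e).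
- by rewrite (IHp _ _ e) (IHq _ _ e).
- by rewrite (IHp _ _ e) (IHq _ _ e).
- by rewrite (IH _ _ (up_ext e)).
- by rewrite (IH _ _ (up_ext e)).
Qed.

Lemma up_comp sigma tau n :
  tsubst (up sigma) (up tau n) = up (fun m => tsubst sigma (tau m)) n.
Proof.
by case: n => //= n; rewrite tsubst_scons_shift tsubst_comp.
Qed.

Lemma fsubst_comp sigma tau p :
  fsubst sigma (fsubst tau p) = fsubst (fun n => tsubst sigma (tau n)) p.
Proof.
elim: p sigma tau => //= [s t|p IHp q IHq|p IHp q IHq|p IHp q IHq|p IH|p IH]
  sigma tau; rewrite ?tsubst_comp ?IHp ?IHq ?IH //.
- by congr All; apply: fsubst_ext; apply: up_comp.
- by congr Ex; apply: fsubst_ext; apply: up_comp.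
Qed.

Lemma up_id : up Var =1 Var.
Proof. by case. Qed.

Lemma fsubst_id p : fsubst Var p = p.
Proof.
elim: p => //= [s t|p -> q ->|p -> q ->|p -> q ->|p IH|p IH] //.
- by rewrite !tsubst_id.
- by rewrite (fsubst_ext _ up_id) IH.
- by rewrite (fsubst_ext _ up_id) IH.
Qed.

(** Merges an instantiation with a substitution already pushed under the binder, so that eliminating
    a block of quantifiers yields one simultaneous substitution. *)
Lemma inst_fsubst_up t sigma p :
  inst t (fsubst (up sigma) p) = fsubst (scons t sigma) p.
Proof.
rewrite /inst fsubst_comp; apply: fsubst_ext => -[|n] //=.
by rewrite tsubst_scons_shift tsubst_id.
Qed.

(** * The deductive system *)

(* The last term of [ts] replaces the innermost variable, that is [Var 0]. *)
Definition bind (ts : seq term) : nat -> term :=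
  foldl (fun sigma t => scons t sigma) Var ts.

Definition defined (G : list form) (t : term) : Prop := derives G (Neq t Bot).

Lemma all_nE G ts p :
  derives G (all_n (size ts) p) -> derives G (fsubst (bind ts) p).
Proof.
(* Inserting the identity substitution and generalising it to [sigma] lets the induction absorb one
   term per quantifier. *)
rewrite /bind -{1}[all_n _ _]fsubst_id; elim: ts Var => //= t ts IH sigma.
by move=> /(AllE t); rewrite inst_fsubst_up; apply: IH.
Qed.

Lemma pall_nE G ts p :
  derives G (psi_true (pall_n (size ts) p)) ->
  List.Forall (defined G) ts ->
  derives G (fsubst (bind ts) (psi_true p)).
Proof.
rewrite /bind -{1}[psi_true _]fsubst_id; elim: ts Var => //= t ts IH sigma.
move=> /(AllE t); rewrite /inst /= -/(inst _ _) inst_fsubst_up => H D.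
by inversion_clear D; apply: IH => //; apply: ImpE H _.
Qed.


(** * Classical propositional reasoning *)

Lemma derives_exfalso G p : derives G Fal -> derives G p.
Proof.
(* Eliminating [Or Fal Fal] makes [Fal] a hypothesis, which stays available under the discharge of
   [RAA]. *)
move=> d; apply: (@OrE G Fal Fal); first exact: OrI1.
- by apply: RAA; apply: Hyp; right; left.
- by apply: RAA; apply: Hyp; right; left.
Qed.

Lemma derives_cases G p q :
  derives (p :: G) q -> derives (Neg p :: G) q -> derives G q.
Proof.
(* The disjunction eliminated is excluded middle for [p], obtained by refuting its negation. *)
apply: OrE; apply: RAA; set N := Neg (Or p (Neg p)).
apply: (@ImpE _ (Or p (Neg p))); first by apply: Hyp; left.
apply: OrI2; apply: ImpI; apply: (@ImpE _ (Or p (Neg p))).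
  by apply: Hyp; right; left.
by apply: OrI1; apply: Hyp; left.
Qed.

Lemma derives_absurd G p q : derives G p -> derives G (Neg p) -> derives G q.
Proof. by move=> d nd; apply: derives_exfalso; apply: ImpE nd d. Qed.

Lemma derives_orN G p q : derives G (Or p q) -> derives G (Neg p) -> derives G q.
Proof.
(* As an antecedent of the goal, [Neg p] becomes a hypothesis of both branches, in place of a
   weakening of [nd]. *)
move=> d nd; apply: (@ImpE _ (Neg p)) => //; apply: OrE d _ _; apply: ImpI.
- by apply: (@derives_absurd _ p); apply: Hyp; [right; left | left].
- by apply: Hyp; right; left.
Qed.

Lemma derives_contra G p q :
  derives G (Imp p q) -> derives G (Neg q) -> derives G (Neg p).
Proof.
move=> pq nq; apply: ImpE nq; apply: ImpE pq; do 3!apply: ImpI.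
apply: (@ImpE _ q); first by apply: Hyp; right; left.
by apply: (@ImpE _ p); apply: Hyp; [right; right; left | left].
Qed.

Lemma derives_contra_or G p q r : derives G (Imp p (Or q r)) ->
  derives G (Neg q) -> derives G (Neg r) -> derives G (Neg p).
Proof.
move=> H nq nr; apply: derives_contra H _; apply: ImpE nr; apply: ImpE nq.
do 3!apply: ImpI; apply: OrE; first by apply: Hyp; left.
- by apply: (@ImpE _ q); apply: Hyp; [do 3!right; left | left].
- by apply: (@ImpE _ r); apply: Hyp; [do 2!right; left | left].
Qed.

Lemma derives_negor G p q :
  derives G (Neg p) -> derives G (Neg q) -> derives G (Neg (Or p q)).
Proof. by apply: derives_contra_or; apply: ImpI; apply: Hyp; left. Qed.

Lemma derives_negand G p q : derives G (Neg q) -> derives G (Neg (And p q)).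
Proof.
by apply: derives_contra; apply: ImpI; apply: AndE2; apply: Hyp; left.
Qed.

(** * Provable equality as a congruence on terms *)

Definition eqv (G : list form) (s t : term) : Prop := derives G (Eq s t).

(** [sigma] assigns terms to the other indices, so [p] can serve as a template with parameters. *)
Lemma eqv_subst G sigma p s t :
  eqv G s t -> derives G (fsubst (scons s sigma) p) ->
  derives G (fsubst (scons t sigma) p).
Proof.
move=> e; have := EqSubst (p := fsubst (up sigma) p) e.
by rewrite !inst_fsubst_up.
Qed.

#[export] Instance eqv_equivalence G : Equivalence (eqv G).
Proof.
have sym s t : eqv G s t -> eqv G t s.
  by move=> e; apply: (eqv_subst (sigma := fun=> s) (p := Eq (Var 0) (Var 1)) e);
     apply: EqRefl.
split=> //; first by move=> t; apply: EqRefl.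
move=> s t u st tu.
exact: (eqv_subst (sigma := fun=> s) (p := Eq (Var 1) (Var 0)) tu).
Qed.

(** Abstracting the symbol to any [f] that commutes with substitution treats all operations at once;
    [Opp] enters as a function that ignores its second argument. *)
Lemma eqv_congr G f s s' t t' :
  (forall sigma u v, tsubst sigma (f u v) = f (tsubst sigma u) (tsubst sigma v)) ->
  eqv G s s' -> eqv G t t' -> eqv G (f s t) (f s' t').
Proof.
move=> fE es et; have := EqRefl G (f s t).
(* Both templates keep [f s t] in [Var 1] and the fixed argument in [Var 2], while [Var 0] is
   rewritten. *)
have /= := eqv_subst (sigma := scons (f s t) (fun=> t))
  (p := Eq (Var 1) (f (Var 0) (Var 2))) es.
have /= := eqv_subst (sigma := scons (f s t) (fun=> s'))
  (p := Eq (Var 1) (f (Var 2) (Var 0))) et.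
by rewrite !fE /= => H2 H1 /H1 /H2.
Qed.

#[export] Instance Add_proper G : Proper (eqv G ==> eqv G ==> eqv G) Add.
Proof. by move=> s s' es t t' et; apply: (eqv_congr (f := Add)). Qed.

#[export] Instance Mul_proper G : Proper (eqv G ==> eqv G ==> eqv G) Mul.
Proof. by move=> s s' es t t' et; apply: (eqv_congr (f := Mul)). Qed.

#[export] Instance Div_proper G : Proper (eqv G ==> eqv G ==> eqv G) Div.
Proof. by move=> s s' es t t' et; apply: (eqv_congr (f := Div)). Qed.

#[export] Instance Opp_proper G : Proper (eqv G ==> eqv G) Opp.
Proof.
by move=> s s' es; apply: (eqv_congr (f := fun u _ => Opp u) _ es es).
Qed.

(** * Rings without commutativity of addition, up to an equivalence *)

Section SetoidRing.
(** [E] and [D] are abstract because the section serves twice: for provable equality of terms, with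
    [D] provable definedness, and for identity of the elements of a model other than bot, with [D]
    trivial. *)
Variables (T : Type) (E : T -> T -> Prop) (D : T -> Prop).
Variables (zero one : T) (add mul : T -> T -> T) (opp : T -> T).
Context {E_equiv : Equivalence E}.
Context {add_proper : Proper (E ==> E ==> E) add}.
Context {mul_proper : Proper (E ==> E ==> E) mul}.
Hypothesis addA : forall x y z, E (add (add x y) z) (add x (add y z)).
Hypothesis add0 : forall x, E (add x zero) x.
Hypothesis addN : forall x, D x -> E (add x (opp x)) zero.
Hypothesis D_opp : forall x, D x -> D (opp x).

Hypothesis D_zero : D zero.
Hypothesis D_add : forall x y, D x -> D y -> D (add x y).
Hypothesis mulC : forall x y, E (mul x y) (mul y x).
Hypothesis mul1 : forall x, E (mul one x) x.
Hypothesis mulD : forall x y z, E (mul x (add y z)) (add (mul x y) (mul x z)).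
Hypothesis D_mul : forall x y, D x -> D y -> D (mul x y).

Lemma setoid_addNl x : D x -> E (add (opp x) x) zero.
Proof.
move=> Dx; have DNx := D_opp Dx.
(* The added summand is zero by [addN] at [opp x]; after reassociation the inner [add x (opp x)]
   cancels. *)
transitivity (add (add (opp x) x) (add (opp x) (opp (opp x)))).
  by rewrite addN // add0; reflexivity.
rewrite addA -[add x _]addA addN // -addA add0; exact: addN.
Qed.

Lemma setoid_add0l x : D x -> E (add zero x) x.
Proof.
by move=> Dx; rewrite -(addN Dx) addA setoid_addNl // add0; reflexivity.
Qed.

Lemma setoid_addIl x y z : D x -> D y -> D z ->
  E (add x y) (add x z) -> E y z.
Proof.
move=> Dx Dy Dz e.
rewrite -(setoid_add0l Dy) -(setoid_add0l Dz) -(setoid_addNl Dx) !addA e.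
reflexivity.
Qed.

Lemma setoid_addIr x y z : D x -> E (add y x) (add z x) -> E y z.
Proof.
by move=> Dx e; rewrite -(add0 y) -(add0 z) -(addN Dx) -!addA e; reflexivity.
Qed.

(* Expand [(1 + 1) * (x + y)] in two ways and cancel. *)
Lemma setoid_addC x y : D x -> D y -> E (add x y) (add y x).
Proof.
have dbl u : E (mul (add one one) u) (add u u).
  by rewrite mulC mulD (mulC u) mul1; reflexivity.
(* Here [e] reads (x + x) + (y + y) = (x + y) + (x + y); cancelling [x] on the left and [y] on the
   right leaves the claim. *)
move=> Dx Dy; have := dbl (add x y); rewrite mulD !dbl => e.
apply: (@setoid_addIl x); [exact: Dx|exact: D_add|exact: D_add|].
apply: (@setoid_addIr y) => //.
by rewrite !addA in e *.
Qed.

(** Since x(0 + 0) = x0, doubling [mul zero x] changes nothing, and cancellation applies. *)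
Lemma setoid_mul0l x : D x -> E (mul zero x) zero.
Proof.
move=> Dx; have D0x := D_mul D_zero Dx.
apply: (setoid_addIl D0x D0x D_zero).
by rewrite add0 (mulC zero x) -mulD add0; reflexivity.
Qed.

(** Both [opp (opp x)] and [x] are right inverses of [opp x]. *)
Lemma setoid_oppK x : D x -> E (opp (opp x)) x.
Proof.
move=> Dx; have DNx := D_opp Dx.
apply: (setoid_addIl DNx) => //; first exact: D_opp.
by rewrite addN // setoid_addNl //; reflexivity.
Qed.

End SetoidRing.

(** * Derivation of the axioms of common meadows *)

Definition theory : list form :=
  (P_axioms ++ List.map psi_true AxFTCpm_cl)%list.

(** Stating lemmas over every context that contains the axioms replaces weakening; as a class, the
    inclusion is found by instance search when a case distinction adds a hypothesis. *)
Class extends_theory (G : list form) : Prop := theory_incl : incl theory G.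

#[export] Instance extends_theory_cons G p :
  extends_theory G -> extends_theory (p :: G).
Proof. by move=> TG q q_G; right; apply: TG. Qed.

#[export] Instance extends_theory_refl : extends_theory theory.
Proof. by []. Qed.

Ltac in_list := repeat (first [left; reflexivity | right]).

Ltac axiom := apply: Hyp; apply: theory_incl; in_list.

Lemma pall_eqE G ts s t :
  derives G (psi_true (pall_n (size ts) (PEq s t))) ->
  List.Forall (defined G) ts ->
  eqv G (tsubst (bind ts) (embed s)) (tsubst (bind ts) (embed t)).
Proof. by move=> H D; apply: AndE2 (AndE2 (pall_nE H D)). Qed.

(** * The axioms of partial meadows on defined terms *)

Section PartialMeadow.
Context {G : list form}.
Context {TG : extends_theory G}.
Implicit Types s t u : term.

Lemma defined_zero : defined G Zero.
Proof. axiom. Qed.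

Lemma defined_one : defined G One.
Proof. axiom. Qed.

Lemma eqv_opp_bot : eqv G (Opp Bot) Bot.
Proof. axiom. Qed.

Lemma eqv_add_bot_r t : eqv G (Add t Bot) Bot.
Proof. by apply: (@all_nE G [:: t] (Eq (Add (Var 0) Bot) Bot)); axiom. Qed.

Lemma eqv_add_bot_l t : eqv G (Add Bot t) Bot.
Proof. by apply: (@all_nE G [:: t] (Eq (Add Bot (Var 0)) Bot)); axiom. Qed.

Lemma eqv_mul_bot_r t : eqv G (Mul t Bot) Bot.
Proof. by apply: (@all_nE G [:: t] (Eq (Mul (Var 0) Bot) Bot)); axiom. Qed.

Lemma eqv_mul_bot_l t : eqv G (Mul Bot t) Bot.
Proof. by apply: (@all_nE G [:: t] (Eq (Mul Bot (Var 0)) Bot)); axiom. Qed.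

Lemma eqv_div_bot_r t : eqv G (Div t Bot) Bot.
Proof. by apply: (@all_nE G [:: t] (Eq (Div (Var 0) Bot) Bot)); axiom. Qed.

Lemma eqv_div_bot_l t : eqv G (Div Bot t) Bot.
Proof. by apply: (@all_nE G [:: t] (Eq (Div Bot (Var 0)) Bot)); axiom. Qed.

Lemma eqv_div_zero t : eqv G (Div t Zero) Bot.
Proof. by apply: (@all_nE G [:: t] (Eq (Div (Var 0) Zero) Bot)); axiom. Qed.

Lemma defined_opp t : defined G t -> defined G (Opp t).
Proof.
apply: derives_contra.
apply: (@all_nE G [:: t] (Imp (Eq (Opp (Var 0)) Bot) (Eq (Var 0) Bot))); axiom.
Qed.

Lemma defined_add s t : defined G s -> defined G t -> defined G (Add s t).
Proof.
apply: derives_contra_or; apply: (@all_nE G [:: t; s] (Imp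
  (Eq (Add (Var 0) (Var 1)) Bot) (Or (Eq (Var 0) Bot) (Eq (Var 1) Bot)))); axiom.
Qed.

Lemma defined_mul s t : defined G s -> defined G t -> defined G (Mul s t).
Proof.
apply: derives_contra_or; apply: (@all_nE G [:: t; s] (Imp
  (Eq (Mul (Var 0) (Var 1)) Bot) (Or (Eq (Var 0) Bot) (Eq (Var 1) Bot)))); axiom.
Qed.

Ltac forall_defined :=
  repeat (first [assumption | apply: List.Forall_cons | apply: List.Forall_nil]).

Ltac partial_axiom := apply; [axiom | by forall_defined].

Lemma eqv_addA_defined s t u : defined G s -> defined G t -> defined G u ->
  eqv G (Add (Add s t) u) (Add s (Add t u)).
Proof.
move=> Ds Dt Du; have := @pall_eqE G [:: u; t; s]
  (PAdd (PAdd (PVar 0) (PVar 1)) (PVar 2)) (PAdd (PVar 0) (PAdd (PVar 1) (PVar 2))).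
partial_axiom.
Qed.

Lemma eqv_addr0_defined s : defined G s -> eqv G (Add s Zero) s.
Proof.
move=> Ds; have := @pall_eqE G [:: s] (PAdd (PVar 0) PZero) (PVar 0).
partial_axiom.
Qed.

Lemma eqv_addrN s : defined G s -> eqv G (Add s (Opp s)) Zero.
Proof.
move=> Ds; have := @pall_eqE G [:: s] (PAdd (PVar 0) (POpp (PVar 0))) PZero.
partial_axiom.
Qed.

Lemma eqv_mulA_defined s t u : defined G s -> defined G t -> defined G u ->
  eqv G (Mul s (Mul t u)) (Mul (Mul s t) u).
Proof.
move=> Ds Dt Du; have := @pall_eqE G [:: u; t; s]
  (PMul (PVar 0) (PMul (PVar 1) (PVar 2))) (PMul (PMul (PVar 0) (PVar 1)) (PVar 2)).
partial_axiom.
Qed.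

Lemma eqv_mulC_defined s t : defined G s -> defined G t ->
  eqv G (Mul s t) (Mul t s).
Proof.
move=> Ds Dt; have := @pall_eqE G [:: t; s]
  (PMul (PVar 0) (PVar 1)) (PMul (PVar 1) (PVar 0)).
partial_axiom.
Qed.

Lemma eqv_mul1l_defined s : defined G s -> eqv G (Mul One s) s.
Proof.
move=> Ds; have := @pall_eqE G [:: s] (PMul POne (PVar 0)) (PVar 0).
partial_axiom.
Qed.

Lemma eqv_mulDr_defined s t u : defined G s -> defined G t -> defined G u ->
  eqv G (Mul s (Add t u)) (Add (Mul s t) (Mul s u)).
Proof.
move=> Ds Dt Du; have := @pall_eqE G [:: u; t; s]
  (PMul (PVar 0) (PAdd (PVar 1) (PVar 2)))
  (PAdd (PMul (PVar 0) (PVar 1)) (PMul (PVar 0) (PVar 2))).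
partial_axiom.
Qed.

Lemma neq_zero_one : derives G (Neq Zero One).
Proof.
(* The translation is a disjunction: one of the sides is bot, or the sides differ. Definedness
   removes the first two disjuncts. *)
have : derives G (psi_true (PNeq PZero POne)) by axiom.
move=> /derives_orN /(_ defined_zero) /derives_orN; apply; exact: defined_one.
Qed.

(** The conjunction has the shape of a translated equation; an axiom with a premise [t != 0]
    translates to a disjunction in which such a conjunction must be refuted. *)
Lemma neg_psi_true_eq p q s t :
  derives G (Neq s t) -> derives G (Neg (And p (And q (Eq s t)))).
Proof.
apply: derives_contra; apply: ImpI; do 2!apply: AndE2.
by apply: Hyp; left.
Qed.

(** A translated equation asserts that both its sides differ from bot; this is where definedness of
    quotients comes from, since [P_axioms] only says when they are bot. *)
Lemma div_defined s t : defined G s -> defined G t -> derives G (Neq t Zero) ->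
  defined G (Div s t) /\ eqv G (Div s t) (Mul s (Div One t)).
Proof.
move=> Ds Dt t0; have H : derives G (fsubst (bind [:: t; s])
    (psi_true (PImp (PNeq (PVar 1) PZero)
      (PEq (PDiv (PVar 0) (PVar 1)) (PMul (PVar 0) (PDiv POne (PVar 1))))))).
  by apply: pall_nE; [axiom | forall_defined].
have {}H := AndE2 (derives_orN H (neg_psi_true_eq _ _ t0)).
by split; [apply: AndE1 H | apply: AndE2 (AndE2 H)].
Qed.

Lemma eqv_divrr_defined t : defined G t -> derives G (Neq t Zero) ->
  eqv G (Div t t) One.
Proof.
move=> Dt t0; have H : derives G (fsubst (bind [:: t])
    (psi_true (PImp (PNeq (PVar 0) PZero) (PEq (PDiv (PVar 0) (PVar 0)) POne)))).
  by apply: pall_nE; [axiom | forall_defined].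
by have := AndE2 (AndE2 (AndE2 (derives_orN H (neg_psi_true_eq _ _ t0)))).
Qed.

Lemma mul_neq_zero s t : defined G s -> defined G t ->
  derives G (Neq s Zero) -> derives G (Neq t Zero) ->
  derives G (Neq (Mul s t) Zero).
Proof.
move=> Ds Dt s0 t0; have H : derives G (fsubst (bind [:: t; s])
    (psi_true (PImp (PAnd (PNeq (PVar 0) PZero) (PNeq (PVar 1) PZero))
      (PNeq (PMul (PVar 0) (PVar 1)) PZero)))).
  by apply: pall_nE; [axiom | forall_defined].
have {}H := derives_orN H.
(* Failure of the conjunctive premise translates sequentially: [s] is zero, or else the first
   conjunct holds and [t] is zero. *)
have {}H := AndE2 (H (derives_negor (neg_psi_true_eq _ _ s0)
  (derives_negand _ (neg_psi_true_eq _ _ t0)))).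
have {}H := derives_orN H (defined_mul Ds Dt).
exact: derives_orN H defined_zero.
Qed.

End PartialMeadow.

(* The context of the first branch is abstract, for otherwise rewriting with
   [eqv H t c] would also act on the hypothesis [Eq t c] inside the context. *)
Lemma eqv_cases c G t u v : extends_theory G ->
  (forall H, extends_theory H -> eqv H t c -> eqv H u v) ->
  eqv (Neq t c :: G) u v -> eqv G u v.
Proof.
by move=> TG H; apply: derives_cases; apply: H; apply: Hyp; left.
Qed.

Ltac hyp := apply: Hyp; in_list.

Ltac bot_simpl := rewrite ?(eqv_add_bot_l, eqv_add_bot_r, eqv_mul_bot_l,
  eqv_mul_bot_r, eqv_div_bot_l, eqv_div_bot_r, eqv_opp_bot).

(** Disposes of the case t = bot, where both sides collapse to bot, and leaves [Neq t Bot] at the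
    head of the context. *)
Ltac bot_case t := apply: (eqv_cases (c := Bot) (t := t));
  [let H := fresh in let TH := fresh in let e := fresh in
   move=> H TH e; rewrite ?e; bot_simpl; reflexivity |].

(** * Ring laws on all terms and their consequences for defined terms *)

Section CommonMeadow.
Context {G : list form}.
Context {TG : extends_theory G}.
Implicit Types s t u : term.

Lemma eqv_addA s t u : eqv G (Add (Add s t) u) (Add s (Add t u)).
Proof. bot_case s; bot_case t; bot_case u; apply: eqv_addA_defined; hyp. Qed.

Lemma eqv_addr0 s : eqv G (Add s Zero) s.
Proof. bot_case s; apply: eqv_addr0_defined; hyp. Qed.

Lemma eqv_mulA s t u : eqv G (Mul (Mul s t) u) (Mul s (Mul t u)).
Proof.
bot_case s; bot_case t; bot_case u; symmetry; apply: eqv_mulA_defined; hyp.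
Qed.

Lemma eqv_mulC s t : eqv G (Mul s t) (Mul t s).
Proof. bot_case s; bot_case t; apply: eqv_mulC_defined; hyp. Qed.

Lemma eqv_mul1l s : eqv G (Mul One s) s.
Proof. bot_case s; apply: eqv_mul1l_defined; hyp. Qed.

Lemma eqv_mulDr s t u : eqv G (Mul s (Add t u)) (Add (Mul s t) (Mul s u)).
Proof. bot_case s; bot_case t; bot_case u; apply: eqv_mulDr_defined; hyp. Qed.

(** Kept to defined terms here: the case distinction on bot uses this law over an extended context,
    hence only once [G] has been generalised. *)
Lemma eqv_addC_defined s t : defined G s -> defined G t ->
  eqv G (Add s t) (Add t s).
Proof.
exact: (setoid_addC (one := One) eqv_addA eqv_addr0 (@eqv_addrN G _)
  (@defined_opp G _) (@defined_add G _) eqv_mulC eqv_mul1l eqv_mulDr).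
Qed.

Lemma eqv_mul0l_defined s : defined G s -> eqv G (Mul Zero s) Zero.
Proof.
exact: (setoid_mul0l eqv_addA eqv_addr0 (@eqv_addrN G _) (@defined_opp G _)
  (@defined_zero G _) eqv_mulC eqv_mulDr (@defined_mul G _)).
Qed.

Lemma eqv_oppK_defined s : defined G s -> eqv G (Opp (Opp s)) s.
Proof.
exact: (setoid_oppK eqv_addA eqv_addr0 (@eqv_addrN G _) (@defined_opp G _)).
Qed.

Lemma eqv_mul_inv_defined s : defined G s -> derives G (Neq s Zero) ->
  eqv G (Mul s (Div One s)) One.
Proof.
move=> Ds s0; have [_ <-] := div_defined Ds Ds s0; exact: eqv_divrr_defined.
Qed.

Lemma eqv_addrN_mul0_defined s : defined G s -> eqv G (Add s (Opp s)) (Mul Zero s).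
Proof.
by move=> Ds; rewrite (eqv_addrN Ds) (eqv_mul0l_defined Ds); reflexivity.
Qed.

Lemma eqv_divrr_add_defined s : defined G s -> derives G (Neq s Zero) ->
  eqv G (Div s s) (Add One (Div Zero s)).
Proof.
move=> Ds s0; have [D1s _] := div_defined defined_one Ds s0.
have [_ ->] := div_defined defined_zero Ds s0.
by rewrite (eqv_divrr_defined Ds s0) (eqv_mul0l_defined D1s) eqv_addr0; reflexivity.
Qed.

Lemma eqv_div1_mul_zero s : defined G s ->
  eqv G (Div One (Mul Zero s)) (Mul (Div One Zero) (Div One s)).
Proof.
by move=> Ds; rewrite (eqv_mul0l_defined Ds) !eqv_div_zero eqv_mul_bot_l; reflexivity.
Qed.

(** Uniqueness of inverses: the right side is also an inverse of [Mul s t]. *)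
Lemma eqv_div1M_defined s t : defined G s -> defined G t ->
  derives G (Neq s Zero) -> derives G (Neq t Zero) ->
  eqv G (Div One (Mul s t)) (Mul (Div One s) (Div One t)).
Proof.
move=> Ds Dt s0 t0.
have invM := eqv_mul_inv_defined (defined_mul Ds Dt) (mul_neq_zero Ds Dt s0 t0).
have e : eqv G (Mul (Mul s t) (Mul (Div One s) (Div One t))) One.
  rewrite (eqv_mulC s t) eqv_mulA -(eqv_mulA s) (eqv_mul_inv_defined Ds s0) eqv_mul1l.
  exact: eqv_mul_inv_defined.
transitivity (Mul (Div One (Mul s t)) One).
  by rewrite (eqv_mulC _ One) eqv_mul1l; reflexivity.
(* The second [One] is the factor just inserted, not the numerator; it is expanded by [e] so that
   1/(st) cancels against st. *)
by rewrite -{2}e -eqv_mulA (eqv_mulC _ (Mul s t)) invM eqv_mul1l; reflexivity.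
Qed.

Lemma eqv_div1_add_mul0_defined s : defined G s ->
  eqv G (Div One (Add One (Mul Zero s))) (Add One (Mul Zero s)).
Proof.
move=> Ds; rewrite (eqv_mul0l_defined Ds) eqv_addr0.
apply: eqv_divrr_defined; first exact: defined_one.
apply: derives_contra neq_zero_one.
apply: ImpI; change (eqv (Eq One Zero :: G) Zero One); symmetry; hyp.
Qed.

End CommonMeadow.

(** * The remaining axioms of common meadows on all terms *)

Section CommonMeadowAxioms.
Context {G : list form}.
Context {TG : extends_theory G}.
Implicit Types s t : term.

Lemma eqv_addC s t : eqv G (Add s t) (Add t s).
Proof. bot_case s; bot_case t; apply: eqv_addC_defined; hyp. Qed.

Lemma eqv_addrN_mul0 s : eqv G (Add s (Opp s)) (Mul Zero s).
Proof. bot_case s; apply: eqv_addrN_mul0_defined; hyp. Qed.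

Lemma eqv_oppK s : eqv G (Opp (Opp s)) s.
Proof. bot_case s; apply: eqv_oppK_defined; hyp. Qed.

Lemma eqv_divE s t : eqv G (Div s t) (Mul s (Div One t)).
Proof.
bot_case s; bot_case t; apply: (eqv_cases (c := Zero) (t := t)) => [H TH e|].
  by rewrite e !eqv_div_zero eqv_mul_bot_r; reflexivity.
by apply: (proj2 (div_defined _ _ _)); hyp.
Qed.

Lemma eqv_divrr s : eqv G (Div s s) (Add One (Div Zero s)).
Proof.
bot_case s; apply: (eqv_cases (c := Zero) (t := s)) => [H TH e|].
  by rewrite e !eqv_div_zero eqv_add_bot_r; reflexivity.
by apply: eqv_divrr_add_defined; hyp.
Qed.

Lemma eqv_div1M s t :
  eqv G (Div One (Mul s t)) (Mul (Div One s) (Div One t)).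
Proof.
apply: (eqv_cases (c := Zero) (t := s)) => [H TH e|].
  by rewrite e; bot_case t; apply: eqv_div1_mul_zero; hyp.
apply: (eqv_cases (c := Zero) (t := t)) => [H TH e|].
  (* Commuting both products gives the shape of the case s = 0. *)
  rewrite e (eqv_mulC (G := H) s) (eqv_mulC (G := H) (Div One s)).
  by bot_case s; apply: eqv_div1_mul_zero; hyp.
bot_case s; bot_case t; apply: eqv_div1M_defined; hyp.
Qed.

Lemma eqv_div1_add_mul0 s :
  eqv G (Div One (Add One (Mul Zero s))) (Add One (Mul Zero s)).
Proof. bot_case s; apply: eqv_div1_add_mul0_defined; hyp. Qed.

End CommonMeadowAxioms.

(** The axioms are sentences, so lifting fixes each of them by computation and [AllI] leaves the
    context unchanged. *)
Lemma map_lift_theory : List.map lift theory = theory.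
Proof. by []. Qed.

Lemma derives_all_n n p : derives theory p -> derives theory (all_n n p).
Proof.
by move=> H; elim: n => //= n IH; apply: AllI; rewrite map_lift_theory.
Qed.

Lemma theory_derives_AxFTCcm phi : In phi AxFTCcm -> derives theory phi.
Proof.
move=> H; repeat (case: H => [<-|H]).
1-14: apply: derives_all_n.
- exact: eqv_addA.
- exact: eqv_addC.
- exact: eqv_addr0.
- exact: eqv_addrN_mul0.
- exact: eqv_mulA.
- exact: eqv_mulC.
- exact: eqv_mul1l.
- exact: eqv_mulDr.
- exact: eqv_oppK.
- exact: eqv_add_bot_r.
- exact: eqv_divE.
- exact: eqv_divrr.
- exact: eqv_div1M.
- exact: eqv_div1_add_mul0.
- exact: (symmetry (eqv_div_zero One)).
Qed.

(** * Models are common meadows *)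

Section ModelFacts.
Variable A : structure.
Hypothesis A_model : is_model A theory.
Implicit Types a b c : A.

Local Notation D a := (a <> bot_ A).

Lemma model_P phi rho : In phi P_axioms -> sat (A := A) rho phi.
Proof. by move=> H; apply: A_model; rewrite /theory in_app_iff; left. Qed.

Lemma model_psi phi rho : In phi AxFTCpm_cl -> sat (A := A) rho (psi_true phi).
Proof.
by move=> H; apply: A_model; rewrite /theory in_app_iff; right; apply: in_map.
Qed.

(** An arbitrary valuation, as the axioms are sentences. *)
Let rho : nat -> A := fun=> bot_ A.

Lemma model_zero_defined : D (zero_ A).
Proof. exact: (@model_P (Neq Zero Bot)
  rho ltac:(in_list)). Qed.

Lemma model_one_defined : D (one_ A).
Proof. exact: (@model_P (Neq One Bot)
  rho ltac:(in_list)). Qed.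

Lemma model_opp_defined a : D a -> D (opp_ a).
Proof.
move=> Da; have /= H := @model_P (all_n 1
  (Imp (Eq (Opp (Var 0)) Bot) (Eq (Var 0) Bot))) rho ltac:(in_list) a.
by move=> /H.
Qed.

Lemma model_add_defined a b : D a -> D b -> D (add_ a b).
Proof.
(* The outermost quantifier binds the highest index, hence [b] is supplied before [a]. *)
move=> Da Db; have /= H := @model_P (all_n 2 (Imp (Eq (Add (Var 0) (Var 1)) Bot)
  (Or (Eq (Var 0) Bot) (Eq (Var 1) Bot)))) rho ltac:(in_list) b a.
by move=> /H [].
Qed.

Lemma model_mul_defined a b : D a -> D b -> D (mul_ a b).
Proof.
move=> Da Db; have /= H := @model_P (all_n 2 (Imp (Eq (Mul (Var 0) (Var 1)) Bot)
  (Or (Eq (Var 0) Bot) (Eq (Var 1) Bot)))) rho ltac:(in_list) b a.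
by move=> /H [].
Qed.

Lemma model_addA a b c : D a -> D b -> D c ->
  add_ (add_ a b) c = add_ a (add_ b c).
Proof.
move=> Da Db Dc; have /= H := @model_psi (pall_n 3
  (PEq (PAdd (PAdd (PVar 0) (PVar 1)) (PVar 2))
       (PAdd (PVar 0) (PAdd (PVar 1) (PVar 2))))) rho ltac:(in_list).
by have [_ []] := H c Dc b Db a Da.
Qed.

Lemma model_addr0 a : D a -> add_ a (zero_ A) = a.
Proof.
move=> Da; have /= H := @model_psi (pall_n 1
  (PEq (PAdd (PVar 0) PZero) (PVar 0))) rho ltac:(in_list).
by have [_ []] := H a Da.
Qed.

Lemma model_addrN a : D a -> add_ a (opp_ a) = zero_ A.
Proof.
move=> Da; have /= H := @model_psi (pall_n 1
  (PEq (PAdd (PVar 0) (POpp (PVar 0))) PZero)) rho ltac:(in_list).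
by have [_ []] := H a Da.
Qed.

Lemma model_mulA a b c : D a -> D b -> D c ->
  mul_ a (mul_ b c) = mul_ (mul_ a b) c.
Proof.
move=> Da Db Dc; have /= H := @model_psi (pall_n 3
  (PEq (PMul (PVar 0) (PMul (PVar 1) (PVar 2)))
       (PMul (PMul (PVar 0) (PVar 1)) (PVar 2)))) rho ltac:(in_list).
by have [_ []] := H c Dc b Db a Da.
Qed.

Lemma model_mulC a b : D a -> D b -> mul_ a b = mul_ b a.
Proof.
move=> Da Db; have /= H := @model_psi (pall_n 2
  (PEq (PMul (PVar 0) (PVar 1)) (PMul (PVar 1) (PVar 0)))) rho ltac:(in_list).
by have [_ []] := H b Db a Da.
Qed.

Lemma model_mul1l a : D a -> mul_ (one_ A) a = a.
Proof.
move=> Da; have /= H := @model_psi (pall_n 1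
  (PEq (PMul POne (PVar 0)) (PVar 0))) rho ltac:(in_list).
by have [_ []] := H a Da.
Qed.

Lemma model_mulDr a b c : D a -> D b -> D c ->
  mul_ a (add_ b c) = add_ (mul_ a b) (mul_ a c).
Proof.
move=> Da Db Dc; have /= H := @model_psi (pall_n 3
  (PEq (PMul (PVar 0) (PAdd (PVar 1) (PVar 2)))
       (PAdd (PMul (PVar 0) (PVar 1)) (PMul (PVar 0) (PVar 2)))))
  rho ltac:(in_list).
by have [_ []] := H c Dc b Db a Da.
Qed.

Lemma model_neq_zero_one : zero_ A <> one_ A.
Proof.
have /= := @model_psi (PNeq PZero POne) rho ltac:(in_list).
by case=> [/model_zero_defined|[/model_one_defined|]].
Qed.

Lemma model_div a b : D a -> D b -> b <> zero_ A ->
  D (div_ a b) /\ div_ a b = mul_ a (div_ (one_ A) b).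
Proof.
move=> Da Db b0; have /= H := @model_psi (pall_n 2 (PImp (PNeq (PVar 1) PZero)
  (PEq (PDiv (PVar 0) (PVar 1)) (PMul (PVar 0) (PDiv POne (PVar 1))))))
  rho ltac:(in_list).
by case: (H b Db a Da) => [[_ []]|[_ [? []]]].
Qed.

Lemma model_divrr a : D a -> a <> zero_ A -> div_ a a = one_ A.
Proof.
move=> Da a0; have /= H := @model_psi (pall_n 1 (PImp (PNeq (PVar 0) PZero)
  (PEq (PDiv (PVar 0) (PVar 0)) POne))) rho ltac:(in_list).
by case: (H a Da) => [[_ []]|[_ [? []]]].
Qed.

Lemma model_div_zero a : div_ a (zero_ A) = bot_ A.
Proof. exact: (@model_P (all_n 1 (Eq (Div (Var 0) Zero) Bot))
  rho ltac:(in_list)). Qed.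

Lemma model_div_bot_l a : div_ (bot_ A) a = bot_ A.
Proof. exact: (@model_P (all_n 1 (Eq (Div Bot (Var 0)) Bot))
  rho ltac:(in_list)). Qed.

Lemma model_div_bot_r a : div_ a (bot_ A) = bot_ A.
Proof. exact: (@model_P (all_n 1 (Eq (Div (Var 0) Bot) Bot))
  rho ltac:(in_list)). Qed.

Lemma model_add_bot_l a : add_ (bot_ A) a = bot_ A.
Proof. exact: (@model_P (all_n 1 (Eq (Add Bot (Var 0)) Bot))
  rho ltac:(in_list)). Qed.

Lemma model_add_bot_r a : add_ a (bot_ A) = bot_ A.
Proof. exact: (@model_P (all_n 1 (Eq (Add (Var 0) Bot) Bot))
  rho ltac:(in_list)). Qed.

Lemma model_mul_bot_l a : mul_ (bot_ A) a = bot_ A.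
Proof. exact: (@model_P (all_n 1 (Eq (Mul Bot (Var 0)) Bot))
  rho ltac:(in_list)). Qed.

Lemma model_mul_bot_r a : mul_ a (bot_ A) = bot_ A.
Proof. exact: (@model_P (all_n 1 (Eq (Mul (Var 0) Bot) Bot))
  rho ltac:(in_list)). Qed.

Lemma model_opp_bot : opp_ (bot_ A) = bot_ A.
Proof. exact: (@model_P (Eq (Opp Bot) Bot)
  rho ltac:(in_list)). Qed.

End ModelFacts.

(* The phantom argument keeps the proof that [A] is a model available to the
   canonical structures declared below. *)
Definition defined_elt (A : structure) (_ : is_model A theory) : Type :=
  {a : A | a <> bot_ A}.

(** * The field of elements other than bot *)

Section FieldOfModel.
Variable A : structure.
Hypothesis A_model : is_model A theory.
Local Notation F := (defined_elt A_model).
Implicit Types x y z : F.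

Definition elt (a : A) (Da : a <> bot_ A) : F := exist _ a Da.

Definition elt_zero : F := elt (model_zero_defined A_model).
Definition elt_one : F := elt (model_one_defined A_model).
Definition elt_opp x : F :=
  elt (model_opp_defined A_model (proj2_sig x)).
Definition elt_add x y : F :=
  elt (model_add_defined A_model (proj2_sig x) (proj2_sig y)).
Definition elt_mul x y : F :=
  elt (model_mul_defined A_model (proj2_sig x) (proj2_sig y)).
(** The inverse of a [fieldType] sends 0 to 0, unlike 1/0 = bot in [A]; the test for zero is decided
    classically. *)
Definition elt_inv x : F :=
  match pselect (proj1_sig x = zero_ A) with
  | left _ => elt_zero
  | right x0 => elt
      (proj1 (model_div A_model (model_one_defined A_model) (proj2_sig x) x0))
  end.

Lemma elt_inj x y : proj1_sig x = proj1_sig y -> x = y.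
Proof.
case: x y => [a Da] [b Db] /= e; subst b; congr exist.
exact: Prop_irrelevance.
Qed.

Lemma elt_addA : associative elt_add.
Proof.
by move=> [a Da] [b Db] [c Dc]; apply: elt_inj; rewrite /= model_addA.
Qed.

Lemma elt_addr0 x : elt_add x elt_zero = x.
Proof. by case: x => a Da; apply: elt_inj; rewrite /= model_addr0. Qed.

Lemma elt_addrN x : elt_add x (elt_opp x) = elt_zero.
Proof. by case: x => a Da; apply: elt_inj; rewrite /= model_addrN. Qed.

Lemma elt_mulA : associative elt_mul.
Proof.
by move=> [a Da] [b Db] [c Dc]; apply: elt_inj; rewrite /= model_mulA.
Qed.

Lemma elt_mulC : commutative elt_mul.
Proof.
by move=> [a Da] [b Db]; apply: elt_inj; rewrite /= model_mulC.
Qed.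

Lemma elt_mul1l : left_id elt_one elt_mul.
Proof. by move=> [a Da]; apply: elt_inj; rewrite /= model_mul1l. Qed.

Lemma elt_mulDr : right_distributive elt_mul elt_add.
Proof.
by move=> [a Da] [b Db] [c Dc]; apply: elt_inj; rewrite /= model_mulDr.
Qed.

Lemma elt_addC : commutative elt_add.
Proof.
move=> x y; have addA' u v w : elt_add (elt_add u v) w = elt_add u (elt_add v w).
  by rewrite elt_addA.
(* Every element of [F] is defined, so [D] can be taken trivial and [E] is identity. *)
exact: (setoid_addC (D := fun=> True) addA' elt_addr0 (fun u _ => elt_addrN u)
  (fun _ _ => I) (fun _ _ _ _ => I) elt_mulC elt_mul1l elt_mulDr).
Qed.

Lemma elt_add0l : left_id elt_zero elt_add.
Proof. by move=> x; rewrite elt_addC elt_addr0. Qed.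

Lemma elt_addNl : left_inverse elt_zero elt_opp elt_add.
Proof. by move=> x; rewrite elt_addC elt_addrN. Qed.

Lemma elt_mulDl : left_distributive elt_mul elt_add.
Proof. by move=> x y z; rewrite elt_mulC elt_mulDr !(elt_mulC z). Qed.

HB.instance Definition _ := gen_eqMixin F.
HB.instance Definition _ := gen_choiceMixin F.
HB.instance Definition _ :=
  GRing.isZmodule.Build F elt_addA elt_addC elt_add0l elt_addNl.

Lemma elt_one_neq0 : elt_one != 0%R :> F.
Proof.
apply/eqP => /(congr1 (@proj1_sig _ _)) /= /esym.
exact: (model_neq_zero_one A_model).
Qed.

HB.instance Definition _ := GRing.Zmodule_isComNzRing.Build F
  elt_mulA elt_mulC elt_mul1l elt_mulDl elt_one_neq0.

Lemma elt_mulVf x : x != 0%R -> elt_mul (elt_inv x) x = 1%R.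
Proof.
case: x => a Da /eqP x0; rewrite elt_mulC; apply: elt_inj => /=.
rewrite /elt_inv /=; case: pselect => [a0|a0] /=.
  by case: x0; apply: elt_inj.
by rewrite -(proj2 (model_div A_model _ _ _)) // (model_divrr A_model).
Qed.

Lemma elt_inv0 : elt_inv 0%R = 0%R.
Proof. by rewrite /elt_inv; case: pselect. Qed.

HB.instance Definition _ := GRing.ComNzRing_isField.Build F elt_mulVf elt_inv0.

Definition elt_val (x : option F) : A := oapp (@proj1_sig _ _) (bot_ A) x.

Lemma elt_val_bij : bijective elt_val.
Proof.
exists (fun a => match pselect (a = bot_ A) with
                 | left _ => None | right Da => Some (elt Da) end).
- move=> [[a Da]|] /=; case: pselect => //= Da'.
  by congr Some; apply: elt_inj.
- by move=> a; case: pselect.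
Qed.

Lemma model_common_meadow : common_meadow A.
Proof.
exists (defined_elt A_model : fieldType), elt_val.
split; first exact: elt_val_bij.
split; [by []|split; [by []|split; [by []|split; [|split; [|split]]]]].
- move=> [x|] [y|] //=;
  by rewrite ?(model_add_bot_l A_model) ?(model_add_bot_r A_model).
- move=> [x|] [y|] //=;
  by rewrite ?(model_mul_bot_l A_model) ?(model_mul_bot_r A_model).
- by move=> [x|] //=; rewrite (model_opp_bot A_model).
- move=> [x|] [y|] //=;
  rewrite ?(model_div_bot_l A_model) ?(model_div_bot_r A_model) //.
  case: eqP => [->|y0] /=; first by rewrite (model_div_zero A_model).
  have y0' : proj1_sig y <> zero_ A by move=> e; apply: y0; apply: elt_inj.
  rewrite (proj2 (model_div A_model (proj2_sig x) (proj2_sig y) y0')).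
  (* For nonzero [y] the inverse in the field is by construction the quotient 1/y of [A]. *)
  congr mul_; rewrite /GRing.inv /= /elt_inv; by case: pselect.
Qed.

End FieldOfModel.

(** * Common meadows are models *)

Lemma eval_iso (A B : structure) (h : A -> B) rho rho' t :
  isomorphism h -> (forall n, rho' n = h (rho n)) ->
  eval rho' t = h (eval rho t).
Proof.
move=> [_ [h0 [h1 [hb [hD [hM [hN hV]]]]]]] e.
by elim: t => //= [s -> t ->|s -> t ->|t ->|s -> t ->].
Qed.

(** Injectivity settles equations and surjectivity the quantifiers. The valuations are related
    pointwise, a form that passes under [scons]. *)
Lemma sat_iso (A B : structure) (h : A -> B) p rho rho' :
  isomorphism h -> (forall n, rho' n = h (rho n)) ->
  sat rho' p <-> sat rho p.
Proof.
move=> h_iso; have [[g hK gK] _] := h_iso.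
have scons_e (sigma : nat -> A) sigma' a : (forall n, sigma' n = h (sigma n)) ->
    forall n, scons (h a) sigma' n = h (scons a sigma n) by move=> e [|n] /=.
elim: p rho rho' => /= [s t|//|p IHp q IHq|p IHp q IHq|p IHp q IHq|p IH|p IH]
  rho rho' e.
- rewrite !(eval_iso _ h_iso e); split=> [/(can_inj hK)|->] //.
- by rewrite (IHp _ _ e) (IHq _ _ e).
- by rewrite (IHp _ _ e) (IHq _ _ e).
- by rewrite (IHp _ _ e) (IHq _ _ e).
- split=> H a; first exact: (proj1 (IH _ _ (scons_e _ _ a e)) (H (h a))).
  by have := proj2 (IH _ _ (scons_e _ _ (g a) e)) (H (g a)); rewrite gK.
- split=> -[a H];
  last by exists (h a); exact: (proj2 (IH _ _ (scons_e _ _ a e)) H).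
  by exists (g a); apply: (proj1 (IH _ _ (scons_e _ _ (g a) e))); rewrite gK.
Qed.

(** The premise on [a] is what the guard [Var 0 != Bot] of a translated quantifier evaluates to in
    an enlargement. *)
Lemma option_defined_ind (T : Type) (Q : option T -> Prop) :
  (forall x, Q (Some x)) -> forall a, (a = None -> False) -> Q a.
Proof. by move=> H [x _|/(_ erefl)]. Qed.

Lemma enlargement_model (F : fieldType) : is_model (enlargement F) theory.
Proof.
(* The form that a translated inequation with zero takes after evaluation. *)
have neq0 (z : F) : z != 0%R ->
    Some z = None \/ Some (0%R : F) = None \/ (Some z = Some 0%R -> False).
  by move=> z0; right; right=> -[] /eqP; rewrite (negPf z0).
move=> p p_in rho; repeat (case: p_in => [<-|p_in]) => /=.
(* These goals come from [P_axioms]; computation leaves division by zero and the two laws on sums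
   and products equal to bot. *)
1-13: try by repeat case.
- by case=> //= a; rewrite eqxx.
- by move=> [b|] [a|] //=; auto.
- by move=> [b|] [a|] //=; auto.
- by do !apply: option_defined_ind => ?; rewrite /= addrA.
- by apply: option_defined_ind => ?; rewrite /= addr0.
- by apply: option_defined_ind => ?; rewrite /= subrr.
- by do !apply: option_defined_ind => ?; rewrite /= mulrA.
- by do !apply: option_defined_ind => ?; rewrite /= mulrC.
- by apply: option_defined_ind => ?; rewrite mul1r.
- by do !apply: option_defined_ind => ?; rewrite /= mulrDr.
- apply: option_defined_ind => y; apply: option_defined_ind => x.
  have [->|y0] := eqVneq y 0%R; first by left.
  right; split; first exact: neq0.
  by rewrite /= (negPf y0) div1r.
- apply: option_defined_ind => x.
  have [->|x0] := eqVneq x 0%R; first by left.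
  right; split; first exact: neq0.
  by rewrite /= (negPf x0) divff.
- by right; right=> -[/esym/eqP]; rewrite oner_eq0.
- apply: option_defined_ind => y; apply: option_defined_ind => x.
  have [->|x0] := eqVneq x 0%R; first by left; left.
  (* The second way for the sequential premise to fail also records that [x] is nonzero. *)
  have [->|y0] := eqVneq y 0%R; first by left; right; split; [apply: neq0|].
  right; split; first by split; apply: neq0.
  by apply: neq0; rewrite mulf_neq0.
Qed.

Lemma common_meadow_model (A : structure) :
  common_meadow A -> is_model A theory.
Proof.
move=> [F [h h_iso]] p p_in rho; have [[g hK gK] _] := h_iso.
(* Every valuation in [A] is the image under [h] of its pullback along the inverse [g]. *)
apply/(sat_iso (rho := g \o rho) _ h_iso); last exact: enlargement_model.
by move=> n /=; rewrite gK.
Qed.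

(* The arguments of [derives] and [is_model] are parsed in [seq_scope], where
   [++] would otherwise be [seq.cat]. *)
Local Notation "s ++ t" := (List.app s t) : seq_scope.

Theorem theorem5p2p1 :
  (forall phi : form,
     In phi AxFTCcm -> derives (P_axioms ++ List.map psi_true AxFTCpm_cl) phi) /\
  (forall A : structure,
     is_model A (P_axioms ++ List.map psi_true AxFTCpm_cl) <-> common_meadow A).
Proof.
split; first exact: theory_derives_AxFTCcm.
move=> A; split; [exact: model_common_meadow | exact: common_meadow_model].
Qed.
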